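(* Let $v,w$, $a,b,c$, $B,C$ be as in the context, and suppose $\xi:=cC+ibB\neq0$. Define $f:\mathbb{C}\to\mathbb{R}$, where $\mathbb{C}=\mathbb{R}^2$ has coordinate $s+it$, by $f=\log(a+bv+cw)-\frac23\log|\xi|$. Then $f$ satisfies the Tzitzéica equation $$\frac{\partial^2f}{\partial z'\,\partial\bar z'}=e^{-2f}-e^f$$ with respect to $z'=\xi^{1/3}(s+it)$, for a fixed cube root $\xi^{1/3}$ of $\xi$.
   Context: Setting. Fix $\theta_0\in[0,2\pi)$ and set $\beta_1=\frac1{\sqrt2}\cos\theta_0-\frac1{\sqrt6}\sin\theta_0$, $\beta_2=-\frac1{\sqrt2}\cos\theta_0-\frac1{\sqrt6}\sin\theta_0$, $\beta_3=\frac2{\sqrt6}\sin\theta_0$, $\gamma_1=-\frac1{\sqrt6}\cos\theta_0-\frac1{\sqrt2}\sin\theta_0$, $\gamma_2=-\frac1{\sqrt6}\cos\theta_0+\frac1{\sqrt2}\sin\theta_0$, $\gamma_3=\frac2{\sqrt6}\cos\theta_0$. Let $y_1,y_2,y_3:\mathbb{R}\to\mathbb{C}$, $v:\mathbb{R}\to\mathbb{R}$ (functions of $s$) and $z_1,z_2,z_3:\mathbb{R}\to\mathbb{C}$, $w:\mathbb{R}\to\mathbb{R}$ (functions of $t$) satisfy, for all $s,t$: $\frac{dy_1}{ds}=\beta_1\overline{y_2y_3}$, $\frac{dy_2}{ds}=\beta_2\overline{y_3y_1}$, $\frac{dy_3}{ds}=\beta_3\overline{y_1y_2}$, $|y_j|^2=\beta_jv+1$;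 $\frac{dz_1}{dt}=\gamma_1\overline{z_2z_3}$, $\frac{dz_2}{dt}=\gamma_2\overline{z_3z_1}$, $\frac{dz_3}{dt}=\gamma_3\overline{z_1z_2}$, $|z_j|^2=\gamma_jw+1$. Then $\operatorname{Im}(y_1y_2y_3)\equiv B$ and $\operatorname{Im}(z_1z_2z_3)\equiv C$ for constants $B,C\in[-1,1]$. Set $a=\frac16$, $b=-\frac12\beta_1\beta_2\beta_3$, $c=-\frac12\gamma_1\gamma_2\gamma_3$. *)

(* Defs.v *)
From Stdlib Require Import Reals.
From Coquelicot Require Import Coquelicot.
Open Scope R_scope.

Definition beta1 (th : R) : R := 1 / sqrt 2 * cos th - 1 / sqrt 6 * sin th.
Definition beta2 (th : R) : R := - (1 / sqrt 2) * cos th - 1 / sqrt 6 * sin th.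
Definition beta3 (th : R) : R := 2 / sqrt 6 * sin th.

Definition gamma1 (th : R) : R := - (1 / sqrt 6) * cos th - 1 / sqrt 2 * sin th.
Definition gamma2 (th : R) : R := - (1 / sqrt 6) * cos th + 1 / sqrt 2 * sin th.
Definition gamma3 (th : R) : R := 2 / sqrt 6 * cos th.

Definition coef_a : R := 1 / 6.
Definition coef_b (th : R) : R := - (1 / 2) * beta1 th * beta2 th * beta3 th.
Definition coef_c (th : R) : R := - (1 / 2) * gamma1 th * gamma2 th * gamma3 th.

(* Both families satisfy this system: the [y_j], [v] with coefficients
   [beta_j], and the [z_j], [w] with coefficients [gamma_j].  The derivatives
   are those of functions of a real variable with values in the real normed
   space of complex numbers. *)
Definition ode_system (k1 k2 k3 : R) (y1 y2 y3 : R -> C) (v : R -> R) : Prop :=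
  forall s : R,
    @is_derive R_AbsRing C_R_NormedModule y1 s (k1 * Cconj (y2 s * y3 s))%C /\
    @is_derive R_AbsRing C_R_NormedModule y2 s (k2 * Cconj (y3 s * y1 s))%C /\
    @is_derive R_AbsRing C_R_NormedModule y3 s (k3 * Cconj (y1 s * y2 s))%C /\
    Cmod (y1 s) ^ 2 = k1 * v s + 1 /\
    Cmod (y2 s) ^ 2 = k2 * v s + 1 /\
    Cmod (y3 s) ^ 2 = k3 * v s + 1.

Definition is_d_x (g : C -> C) (z l : C) : Prop :=
  @is_derive R_AbsRing C_R_NormedModule (fun x : R => g (x, Im z)) (Re z) l.

Definition is_d_y (g : C -> C) (z l : C) : Prop :=
  @is_derive R_AbsRing C_R_NormedModule (fun y : R => g (Re z, y)) (Im z) l.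

(* Wirtinger derivatives, relationally: [is_d_z g z l] says that the first
   partial derivatives of [g] at [z] exist and that the z-derivative is [l]. *)
Definition is_d_z (g : C -> C) (z l : C) : Prop :=
  exists gx gy : C,
    is_d_x g z gx /\ is_d_y g z gy /\ l = ((gx - Ci * gy) / 2)%C.

Definition is_d_zbar (g : C -> C) (z l : C) : Prop :=
  exists gx gy : C,
    is_d_x g z gx /\ is_d_y g z gy /\ l = ((gx + Ci * gy) / 2)%C.

Definition is_d_z_zbar (g : C -> C) (z l : C) : Prop :=
  exists h : C -> C,
    @locally C_UniformSpace z (fun z0 => is_d_zbar g z0 (h z0)) /\
    is_d_z h z l.

Definition xi_of (th B C0 : R) : C :=
  (coef_c th * C0 + Ci * (coef_b th * B))%C.

Definition conf_factor (th : R) (v w : R -> R) (p : C) : R :=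
  coef_a + coef_b th * v (Re p) + coef_c th * w (Im p).

(* [ln] is 0 at nonpositive arguments, so this is the intended function only
   where [conf_factor] is positive. *)
Definition tz_f (th B C0 : R) (v w : R -> R) (p : C) : R :=
  ln (conf_factor th v w p) - 2 / 3 * ln (Cmod (xi_of th B C0)).

(* The real function [f], given in the coordinate [s + i t], satisfies the
   equation with respect to [z' = om * (s + i t)]: its expression in the
   coordinate [z'] is [z' |-> f (z' / om)], differentiated at [om * p]. *)
Definition tzitzeica_wrt (om : C) (f : C -> R) : Prop :=
  forall p : C,
    is_d_z_zbar (fun z' : C => RtoC (f (z' / om)%C)) (om * p)%C
      (RtoC (exp (- 2 * f p) - exp (f p))).

(* Main.v *)
Require Import Defs.
From Stdlib Require Import Reals Lra.
From Coquelicot Require Import Coquelicot.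
Open Scope R_scope.

(** Write [k], [l] for the triples [beta], [gamma], and [F = a + b v + c w].

    Differentiating [v = sum_j k_j |y_j|^2] twice along the system gives
    [v'' = - 2 v - 12 b v^2] and [v'^2 = 4 (1 - v^2 / 2 - 2 b v^3 - B^2)],
    where only [sum k_j = 0] and [sum k_j^2 = 1] are used; the same holds for
    [w], with [c] and [C0] ([ode_system_energy]).  Substituted into
    [F Lap F - |grad F|^2], these formulas leave [4 |xi|^2 - 4 F^3], because
    [b^2 + c^2 = 1 / 216] ([conformal_factor_identity]).  Hence
    [Lap (ln F) / 4 = |xi|^2 / F^2 - F], and passing to the coordinate
    [om * (s + i t)], with [|om|^3 = |xi|], divides this by [|om|^2] and turns it
    into [exp (- 2 f) - exp f], as [exp f = F / |om|^2].

    For positivity, [6 F = sum_j k_j^2 |y_m y_n z_j|^2], where [m] and [n] are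
    the two indices other than [j], and the same with the two
    systems exchanged ([conformal_factor_as_norm]); this rests on the
    orthonormality of the triples.  If [b B <> 0], all [k_j] and all [y_j] are
    nonzero, while the [|z_j|^2] are nonnegative with sum 3, so the sum is
    positive.  If [b B = 0], then [c C0 <> 0] since [xi <> 0], and the exchanged
    formula applies. *)

(** * Complex-valued functions of a real variable, by components *)

Lemma is_derive_Re (g : R -> C) (x : R) (l : C) :
  @is_derive R_AbsRing C_R_NormedModule g x l ->
  is_derive (fun t => Re (g t)) x (Re l).
Proof.
  intros H.
  exact (@filterdiff_comp' _ _ C_R_NormedModule _ g (fun c : C => fst c) x
    (fun y => scal y l) _ H (filterdiff_linear _ is_linear_fst)).
Qed.

Lemma is_derive_Im (g : R -> C) (x : R) (l : C) :
  @is_derive R_AbsRing C_R_NormedModule g x l ->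
  is_derive (fun t => Im (g t)) x (Im l).
Proof.
  intros H.
  exact (@filterdiff_comp' _ _ C_R_NormedModule _ g (fun c : C => snd c) x
    (fun y => scal y l) _ H (filterdiff_linear _ is_linear_snd)).
Qed.

Lemma is_derive_C_pair (f g : R -> R) (x lf lg : R) :
  is_derive f x lf -> is_derive g x lg ->
  @is_derive R_AbsRing C_R_NormedModule (fun t => (f t, g t)) x (lf, lg).
Proof.
  intros Hf Hg.
  refine (@filterdiff_comp'_2 _ _ _ _ C_R_NormedModule f g (fun a b => (a, b)) x
    _ _ (fun a b => (a, b)) Hf Hg _).
  apply (@filterdiff_linear R_AbsRing
    (prod_NormedModule R_AbsRing R_NormedModule R_NormedModule)).
  apply is_linear_prod; [apply is_linear_fst | apply is_linear_snd].
Qed.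

(** For a real function with equal mixed second partial derivatives,
    the mixed Wirtinger derivative is a quarter of the Laplacian. *)
Lemma is_d_z_zbar_real (g gx gy gxx gxy gyy : R -> R -> R) :
  (forall x y, is_derive (fun t => g t y) x (gx x y)) ->
  (forall x y, is_derive (fun t => g x t) y (gy x y)) ->
  (forall x y, is_derive (fun t => gx t y) x (gxx x y)) ->
  (forall x y, is_derive (fun t => gx x t) y (gxy x y)) ->
  (forall x y, is_derive (fun t => gy t y) x (gxy x y)) ->
  (forall x y, is_derive (fun t => gy x t) y (gyy x y)) ->
  forall p : C, is_d_z_zbar (fun z => RtoC (g (Re z) (Im z))) p
    (RtoC ((gxx (Re p) (Im p) + gyy (Re p) (Im p)) / 4)).
Proof.
  intros Hx Hy Hxx Hxy Hyx Hyy p.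
  exists (fun z => (gx (Re z) (Im z) / 2, gy (Re z) (Im z) / 2)); split.
  - apply filter_forall; intros z.
    exists (RtoC (gx (Re z) (Im z))), (RtoC (gy (Re z) (Im z))).
    split; [|split].
    + apply is_derive_C_pair; [apply Hx | apply (is_derive_const 0)].
    + apply is_derive_C_pair; [apply Hy | apply (is_derive_const 0)].
    + apply injective_projections; simpl; field.
  - exists (gxx (Re p) (Im p) / 2, gxy (Re p) (Im p) / 2),
      (gxy (Re p) (Im p) / 2, gyy (Re p) (Im p) / 2).
    assert (H2 : forall f x l, is_derive f x l -> is_derive (fun t => f t / 2) x (l / 2)).
    { intros f x l H. auto_derive; [now exists l|].
      replace (Derive _ x) with l by (symmetry; now apply is_derive_unique).
      field. }
    split; [|split].
    + apply is_derive_C_pair; apply H2; [apply Hxx | apply Hyx].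
    + apply is_derive_C_pair; apply H2; [apply Hxy | apply Hyy].
    + apply injective_projections; simpl; field.
Qed.

(** * Consequences of the differential system *)

Lemma Cmod_pow2 (z : C) : Cmod z ^ 2 = Re z ^ 2 + Im z ^ 2.
Proof.
  unfold Cmod. rewrite pow2_sqrt; [reflexivity|].
  apply Rplus_le_le_0_compat; apply pow2_ge_0.
Qed.

(** The system for [y_j = p_j + i q_j] in real components.  The first-order
    equation is the energy integral of the second-order one.  Here
    [v' = 2 Re (y1 y2 y3)], because [v] is the sum of the [k_j |y_j|^2]; this
    expression also shows that [v] is differentiable.  With
    [b = - k1 k2 k3 / 2] the right-hand sides are [- 2 v - 12 b v^2] and
    [4 (1 - v^2 / 2 - 2 b v^3 - B^2)]. *)
Lemma real_system_energy (k1 k2 k3 : R) (p1 q1 p2 q2 p3 q3 v : R -> R) (B s : R) :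
  k1 + k2 + k3 = 0 -> k1 ^ 2 + k2 ^ 2 + k3 ^ 2 = 1 ->
  is_derive p1 s (k1 * (p2 s * p3 s - q2 s * q3 s)) ->
  is_derive q1 s (- k1 * (p2 s * q3 s + q2 s * p3 s)) ->
  is_derive p2 s (k2 * (p3 s * p1 s - q3 s * q1 s)) ->
  is_derive q2 s (- k2 * (p3 s * q1 s + q3 s * p1 s)) ->
  is_derive p3 s (k3 * (p1 s * p2 s - q1 s * q2 s)) ->
  is_derive q3 s (- k3 * (p1 s * q2 s + q1 s * p2 s)) ->
  (forall t, p1 t ^ 2 + q1 t ^ 2 = k1 * v t + 1) ->
  (forall t, p2 t ^ 2 + q2 t ^ 2 = k2 * v t + 1) ->
  (forall t, p3 t ^ 2 + q3 t ^ 2 = k3 * v t + 1) ->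
  (p1 s * p2 s - q1 s * q2 s) * q3 s + (p1 s * q2 s + q1 s * p2 s) * p3 s = B ->
  let v1 := fun t => 2 * ((p1 t * p2 t - q1 t * q2 t) * p3 t
                          - (p1 t * q2 t + q1 t * p2 t) * q3 t) in
  is_derive v s (v1 s) /\
  is_derive v1 s (- 2 * v s + 6 * (k1 * k2 * k3) * v s ^ 2) /\
  v1 s ^ 2 = 4 * (1 - v s ^ 2 / 2 + k1 * k2 * k3 * v s ^ 3 - B ^ 2).
Proof.
  intros Hs Hq P1 Q1 P2 Q2 P3 Q3 M1 M2 M3 HB v1.
  assert (EX : ex_derive p1 s /\ ex_derive q1 s /\ ex_derive p2 s /\ ex_derive q2 s
    /\ ex_derive p3 s /\ ex_derive q3 s) by (repeat split; eexists; eassumption).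
  destruct EX as (E1 & F1 & E2 & F2 & E3 & F3).
  apply is_derive_unique in P1, Q1, P2, Q2, P3, Q3.
  split; [|split].
  - apply is_derive_ext with (f := fun t =>
      k1 * (p1 t ^ 2 + q1 t ^ 2) + k2 * (p2 t ^ 2 + q2 t ^ 2)
      + k3 * (p3 t ^ 2 + q3 t ^ 2)).
    { intros t. rewrite M1, M2, M3.
      change (k1 * (k1 * v t + 1) + k2 * (k2 * v t + 1) + k3 * (k3 * v t + 1) = v t).
      transitivity ((k1 ^ 2 + k2 ^ 2 + k3 ^ 2) * v t + (k1 + k2 + k3)); [ring|].
      rewrite Hq, Hs; ring. }
    auto_derive; [repeat split; assumption|].
    change (Derive (fun x => p1 x) s) with (Derive p1 s).
    change (Derive (fun x => q1 x) s) with (Derive q1 s).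
    change (Derive (fun x => p2 x) s) with (Derive p2 s).
    change (Derive (fun x => q2 x) s) with (Derive q2 s).
    change (Derive (fun x => p3 x) s) with (Derive p3 s).
    change (Derive (fun x => q3 x) s) with (Derive q3 s).
    rewrite P1, Q1, P2, Q2, P3, Q3.
    transitivity ((k1 ^ 2 + k2 ^ 2 + k3 ^ 2) * v1 s); unfold v1; [ring|].
    rewrite Hq; ring.
  - unfold v1. auto_derive; [repeat split; assumption|].
    change (Derive (fun x => p1 x) s) with (Derive p1 s).
    change (Derive (fun x => q1 x) s) with (Derive q1 s).
    change (Derive (fun x => p2 x) s) with (Derive p2 s).
    change (Derive (fun x => q2 x) s) with (Derive q2 s).
    change (Derive (fun x => p3 x) s) with (Derive p3 s).
    change (Derive (fun x => q3 x) s) with (Derive q3 s).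
    rewrite P1, Q1, P2, Q2, P3, Q3.
    (* The derivative of [y1 y2 y3] is the sum over [j] of
       [k_j] times the squared moduli of the other two functions. *)
    transitivity (2 * (k1 * (p2 s ^ 2 + q2 s ^ 2) * (p3 s ^ 2 + q3 s ^ 2)
      + k2 * (p3 s ^ 2 + q3 s ^ 2) * (p1 s ^ 2 + q1 s ^ 2)
      + k3 * (p1 s ^ 2 + q1 s ^ 2) * (p2 s ^ 2 + q2 s ^ 2))); [ring|].
    rewrite M1, M2, M3.
    transitivity (2 * (3 * (k1 * k2 * k3) * v s ^ 2
      + ((k1 + k2 + k3) ^ 2 - (k1 ^ 2 + k2 ^ 2 + k3 ^ 2)) * v s
      + (k1 + k2 + k3))); [ring|].
    rewrite Hq, Hs; ring.
  - rewrite <- HB. unfold v1.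
    transitivity (4 * ((p1 s ^ 2 + q1 s ^ 2) * (p2 s ^ 2 + q2 s ^ 2)
      * (p3 s ^ 2 + q3 s ^ 2)
      - ((p1 s * p2 s - q1 s * q2 s) * q3 s + (p1 s * q2 s + q1 s * p2 s) * p3 s) ^ 2));
      [ring|].
    rewrite M1, M2, M3.
    transitivity (4 * (1 + (k1 + k2 + k3) * v s
      + ((k1 + k2 + k3) ^ 2 - (k1 ^ 2 + k2 ^ 2 + k3 ^ 2)) / 2 * v s ^ 2
      + k1 * k2 * k3 * v s ^ 3
      - ((p1 s * p2 s - q1 s * q2 s) * q3 s + (p1 s * q2 s + q1 s * p2 s) * p3 s) ^ 2));
      [field|].
    rewrite Hq, Hs; field.
Qed.

Lemma ode_system_energy (k1 k2 k3 : R) (y1 y2 y3 : R -> C) (v : R -> R) (B : R) :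
  k1 + k2 + k3 = 0 -> k1 ^ 2 + k2 ^ 2 + k3 ^ 2 = 1 ->
  ode_system k1 k2 k3 y1 y2 y3 v ->
  (forall s, Im (y1 s * y2 s * y3 s)%C = B) ->
  exists v1 : R -> R, forall s,
    is_derive v s (v1 s) /\
    is_derive v1 s (- 2 * v s + 6 * (k1 * k2 * k3) * v s ^ 2) /\
    v1 s ^ 2 = 4 * (1 - v s ^ 2 / 2 + k1 * k2 * k3 * v s ^ 3 - B ^ 2).
Proof.
  intros Hs Hq Hode HB.
  exists (fun s => 2 * Re (y1 s * y2 s * y3 s)%C); intros s.
  destruct (Hode s) as (D1 & D2 & D3 & _).
  refine (real_system_energy k1 k2 k3
    (fun t => Re (y1 t)) (fun t => Im (y1 t)) (fun t => Re (y2 t)) (fun t => Im (y2 t))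
    (fun t => Re (y3 t)) (fun t => Im (y3 t)) v B s Hs Hq _ _ _ _ _ _ _ _ _ (HB s)).
  - refine (eq_ind _ (is_derive _ s) (is_derive_Re _ _ _ D1) _ _);
      unfold Re, Im; simpl; ring.
  - refine (eq_ind _ (is_derive _ s) (is_derive_Im _ _ _ D1) _ _);
      unfold Re, Im; simpl; ring.
  - refine (eq_ind _ (is_derive _ s) (is_derive_Re _ _ _ D2) _ _);
      unfold Re, Im; simpl; ring.
  - refine (eq_ind _ (is_derive _ s) (is_derive_Im _ _ _ D2) _ _);
      unfold Re, Im; simpl; ring.
  - refine (eq_ind _ (is_derive _ s) (is_derive_Re _ _ _ D3) _ _);
      unfold Re, Im; simpl; ring.
  - refine (eq_ind _ (is_derive _ s) (is_derive_Im _ _ _ D3) _ _);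
      unfold Re, Im; simpl; ring.
  - intros t. rewrite <- Cmod_pow2. apply Hode.
  - intros t. rewrite <- Cmod_pow2. apply Hode.
  - intros t. rewrite <- Cmod_pow2. apply Hode.
Qed.

(** * The logarithm of a sum of functions of one variable each *)

(** The mixed Wirtinger derivative of [ln F], where [F = a + b v(s) + c w(t)],
    with respect to a coordinate [z] such that [s + i t = z (m + i n)]: the
    linear change of coordinates contributes the factor [m^2 + n^2]. *)
Lemma is_d_z_zbar_ln_separated (v v1 v2 w w1 w2 : R -> R) (a b c m n r : R) :
  (forall s, is_derive v s (v1 s)) -> (forall s, is_derive v1 s (v2 s)) ->
  (forall t, is_derive w t (w1 t)) -> (forall t, is_derive w1 t (w2 t)) ->
  (forall s t, 0 < a + b * v s + c * w t) ->
  forall (p : C) (s t : R),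
    s = Re p * m - Im p * n -> t = Re p * n + Im p * m ->
  is_d_z_zbar (fun z => RtoC (ln (a + b * v (Re z * m - Im z * n)
                                    + c * w (Re z * n + Im z * m)) - r)) p
    (RtoC ((m ^ 2 + n ^ 2) / 4 *
      (((a + b * v s + c * w t) * (b * v2 s + c * w2 t)
        - (b ^ 2 * v1 s ^ 2 + c ^ 2 * w1 t ^ 2)) / (a + b * v s + c * w t) ^ 2))).
Proof.
  intros Dv Dv1 Dw Dw1 HF p s t Es Et.
  assert (Uv : forall x, Derive (fun x => v x) x = v1 x)
    by (intros x; apply is_derive_unique, Dv).
  assert (Uv1 : forall x, Derive (fun x => v1 x) x = v2 x)
    by (intros x; apply is_derive_unique, Dv1).
  assert (Uw : forall x, Derive (fun x => w x) x = w1 x)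
    by (intros x; apply is_derive_unique, Dw).
  assert (Uw1 : forall x, Derive (fun x => w1 x) x = w2 x)
    by (intros x; apply is_derive_unique, Dw1).
  assert (Xv : forall x, ex_derive (fun x => v x) x) by (intros x; eexists; apply Dv).
  assert (Xv1 : forall x, ex_derive (fun x => v1 x) x) by (intros x; eexists; apply Dv1).
  assert (Xw : forall x, ex_derive (fun x => w x) x) by (intros x; eexists; apply Dw).
  assert (Xw1 : forall x, ex_derive (fun x => w1 x) x) by (intros x; eexists; apply Dw1).
  pose (S x y := x * m - y * n). pose (T x y := x * n + y * m).
  pose (F x y := a + b * v (S x y) + c * w (T x y)).
  pose (Fx x y := b * v1 (S x y) * m + c * w1 (T x y) * n).
  pose (Fy x y := - b * v1 (S x y) * n + c * w1 (T x y) * m).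
  pose (Fxx x y := b * v2 (S x y) * m ^ 2 + c * w2 (T x y) * n ^ 2).
  pose (Fxy x y := - b * v2 (S x y) * m * n + c * w2 (T x y) * m * n).
  pose (Fyy x y := b * v2 (S x y) * n ^ 2 + c * w2 (T x y) * m ^ 2).
  assert (HF0 : forall x y, 0 < F x y) by (intros x y; apply HF).
  assert (HF1 : forall x y, F x y <> 0) by (intros x y; specialize (HF0 x y); lra).
  pose proof (is_d_z_zbar_real
    (fun x y => ln (F x y) - r)
    (fun x y => Fx x y / F x y) (fun x y => Fy x y / F x y)
    (fun x y => (Fxx x y * F x y - Fx x y * Fx x y) / F x y ^ 2)
    (fun x y => (Fxy x y * F x y - Fx x y * Fy x y) / F x y ^ 2)
    (fun x y => (Fyy x y * F x y - Fy x y * Fy x y) / F x y ^ 2)) as H.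
  assert (E : (m ^ 2 + n ^ 2) / 4 *
      (((a + b * v s + c * w t) * (b * v2 s + c * w2 t)
        - (b ^ 2 * v1 s ^ 2 + c ^ 2 * w1 t ^ 2)) / (a + b * v s + c * w t) ^ 2)
    = ((Fxx (Re p) (Im p) * F (Re p) (Im p) - Fx (Re p) (Im p) * Fx (Re p) (Im p))
         / F (Re p) (Im p) ^ 2
       + (Fyy (Re p) (Im p) * F (Re p) (Im p) - Fy (Re p) (Im p) * Fy (Re p) (Im p))
         / F (Re p) (Im p) ^ 2) / 4).
  { unfold Fxx, Fyy, Fx, Fy, F, S, T. rewrite <- Es, <- Et. field.
    specialize (HF s t). lra. }
  rewrite E. apply H; clear H E Es Et p s t; intros x y;
    specialize (HF0 x y); specialize (HF1 x y);
    unfold Fx, Fy, Fxx, Fxy, Fyy, F, S, T in *;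
    (auto_derive; [repeat split; auto|]);
    change (x * m + - (y * n)) with (x * m - y * n);
    rewrite ?Uv, ?Uv1, ?Uw, ?Uw1; field; exact HF1.
Qed.

(** * The coefficients *)

(** The three vectors [(1, 1, 1) / sqrt 3], [k] and [l] of R^3 are
    orthonormal.  The last three equations, which follow from the others, say
    that the matrix with these rows also has columns of norm 1. *)
Definition orthonormal_coefs (k1 k2 k3 l1 l2 l3 : R) : Prop :=
  k1 + k2 + k3 = 0 /\ k1 ^ 2 + k2 ^ 2 + k3 ^ 2 = 1 /\
  l1 + l2 + l3 = 0 /\ l1 ^ 2 + l2 ^ 2 + l3 ^ 2 = 1 /\
  k1 * l1 + k2 * l2 + k3 * l3 = 0 /\
  k1 ^ 2 + l1 ^ 2 = 2 / 3 /\ k2 ^ 2 + l2 ^ 2 = 2 / 3 /\ k3 ^ 2 + l3 ^ 2 = 2 / 3.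

Lemma orthonormal_coefs_sym (k1 k2 k3 l1 l2 l3 : R) :
  orthonormal_coefs k1 k2 k3 l1 l2 l3 -> orthonormal_coefs l1 l2 l3 k1 k2 k3.
Proof. unfold orthonormal_coefs. intuition lra. Qed.

Lemma inv_sqrt_sqr (x : R) : 0 < x -> (1 / sqrt x) ^ 2 = 1 / x.
Proof.
  intros Hx. replace ((1 / sqrt x) ^ 2) with (1 / sqrt x ^ 2).
  - rewrite pow2_sqrt by lra. reflexivity.
  - field. apply Rgt_not_eq, sqrt_lt_R0, Hx.
Qed.

Lemma beta_gamma_orthonormal (th : R) :
  orthonormal_coefs (beta1 th) (beta2 th) (beta3 th)
    (gamma1 th) (gamma2 th) (gamma3 th).
Proof.
  pose proof (inv_sqrt_sqr 2 ltac:(lra)) as H2.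
  pose proof (inv_sqrt_sqr 6 ltac:(lra)) as H6.
  pose proof (sin2_cos2 th) as HT. rewrite !Rsqr_pow2 in HT.
  unfold orthonormal_coefs, beta1, beta2, beta3, gamma1, gamma2, gamma3.
  replace (2 / sqrt 6) with (2 * (1 / sqrt 6)) by (unfold Rdiv; ring).
  set (r := 1 / sqrt 2) in *. set (q := 1 / sqrt 6) in *.
  set (S := sin th) in *. set (K := cos th) in *.
  assert (HS : S ^ 2 = 1 - K ^ 2) by lra.
  repeat split; ring_simplify; rewrite ?H2, ?H6, ?HS; field.
Qed.

(** These products are, up to sign, [sin (3 th) / sqrt 54] and
    [cos (3 th) / sqrt 54]. *)
Lemma beta_gamma_prod_sqr (th : R) :
  (beta1 th * beta2 th * beta3 th) ^ 2 + (gamma1 th * gamma2 th * gamma3 th) ^ 2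
  = 1 / 54.
Proof.
  pose proof (inv_sqrt_sqr 2 ltac:(lra)) as H2.
  pose proof (inv_sqrt_sqr 6 ltac:(lra)) as H6.
  pose proof (sin2_cos2 th) as HT. rewrite !Rsqr_pow2 in HT.
  unfold beta1, beta2, beta3, gamma1, gamma2, gamma3.
  replace (2 / sqrt 6) with (2 * (1 / sqrt 6)) by (unfold Rdiv; ring).
  set (r := 1 / sqrt 2) in *. set (q := 1 / sqrt 6) in *.
  set (S := sin th) in *. set (K := cos th) in *.
  transitivity (4 * q ^ 2 * (S ^ 2 * (q ^ 2 * S ^ 2 - r ^ 2 * K ^ 2) ^ 2
    + K ^ 2 * (q ^ 2 * K ^ 2 - r ^ 2 * S ^ 2) ^ 2)); [ring|].
  replace (S ^ 2) with (1 - K ^ 2) by lra.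
  rewrite H2, H6; field.
Qed.

(** * Positivity of the conformal factor *)

(** Six times the conformal factor is the squared norm of the s-derivative of
    [(y1 z1, y2 z2, y3 z3)], since [|y_j|^2 = k_j v + 1] and
    [|z_j|^2 = l_j w + 1]; here [b = - k1 k2 k3 / 2] and [c = - l1 l2 l3 / 2]. *)
Lemma conformal_factor_as_norm (k1 k2 k3 l1 l2 l3 v w : R) :
  orthonormal_coefs k1 k2 k3 l1 l2 l3 ->
  1 - 3 * (k1 * k2 * k3) * v - 3 * (l1 * l2 * l3) * w =
  k1 ^ 2 * ((k2 * v + 1) * (k3 * v + 1) * (l1 * w + 1))
  + k2 ^ 2 * ((k3 * v + 1) * (k1 * v + 1) * (l2 * w + 1))
  + k3 ^ 2 * ((k1 * v + 1) * (k2 * v + 1) * (l3 * w + 1)).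
Proof.
  intros (Hk & Hk2 & Hl & Hl2 & Hkl & H1 & H2 & H3).
  set (e := k1 * k2 * k3).
  assert (Hprod : forall x1 x2 x3, x1 + x2 + x3 = 0 ->
    x1 ^ 3 + x2 ^ 3 + x3 ^ 3 = 3 * (x1 * x2 * x3)).
  { intros x1 x2 x3 Hx. replace x3 with (- x1 - x2) by lra. ring. }
  assert (A : k1 ^ 2 * l1 + k2 ^ 2 * l2 + k3 ^ 2 * l3 = - 3 * (l1 * l2 * l3)).
  { replace (- 3 * (l1 * l2 * l3)) with (- (l1 ^ 3 + l2 ^ 3 + l3 ^ 3))
      by (rewrite (Hprod _ _ _ Hl); ring).
    replace (k1 ^ 2) with (2 / 3 - l1 ^ 2) by lra.
    replace (k2 ^ 2) with (2 / 3 - l2 ^ 2) by lra.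
    replace (k3 ^ 2) with (2 / 3 - l3 ^ 2) by lra.
    transitivity (2 / 3 * (l1 + l2 + l3) - (l1 ^ 3 + l2 ^ 3 + l3 ^ 3)); [ring|].
    rewrite Hl; ring. }
  (* Each [k_j] is a root of [x^3 - x / 2 - e]. *)
  assert (Q : k1 * k2 + k2 * k3 + k3 * k1 = - (1 / 2)).
  { assert ((k1 + k2 + k3) ^ 2 = 0) by (rewrite Hk; ring). nra. }
  assert (Hcub : forall x, (x - k1) * (x - k2) * (x - k3) = 0 -> x ^ 3 = x / 2 + e).
  { intros x Hx.
    transitivity ((x - k1) * (x - k2) * (x - k3) + (k1 + k2 + k3) * x ^ 2
      - (k1 * k2 + k2 * k3 + k3 * k1) * x + e); [unfold e; ring|].
    rewrite Hx, Hk, Q; field. }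
  assert (D : k1 ^ 3 * l1 + k2 ^ 3 * l2 + k3 ^ 3 * l3 = 0).
  { rewrite (Hcub k1), (Hcub k2), (Hcub k3) by ring.
    transitivity ((k1 * l1 + k2 * l2 + k3 * l3) / 2 + e * (l1 + l2 + l3)); [field|].
    rewrite Hkl, Hl; field. }
  symmetry.
  transitivity ((k1 ^ 2 + k2 ^ 2 + k3 ^ 2)
    + v * ((k1 ^ 2 + k2 ^ 2 + k3 ^ 2) * (k1 + k2 + k3) - (k1 ^ 3 + k2 ^ 3 + k3 ^ 3))
    + v ^ 2 * e * (k1 + k2 + k3)
    + w * (k1 ^ 2 * l1 + k2 ^ 2 * l2 + k3 ^ 2 * l3)
    + v * w * ((k1 ^ 2 * l1 + k2 ^ 2 * l2 + k3 ^ 2 * l3) * (k1 + k2 + k3)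
               - (k1 ^ 3 * l1 + k2 ^ 3 * l2 + k3 ^ 3 * l3))
    + v ^ 2 * w * e * (k1 * l1 + k2 * l2 + k3 * l3)); [unfold e; ring|].
  rewrite A, D, (Hprod _ _ _ Hk), Hkl, Hk, Hk2. fold e. ring.
Qed.

Lemma conformal_factor_pos (k1 k2 k3 l1 l2 l3 v w : R) :
  orthonormal_coefs k1 k2 k3 l1 l2 l3 ->
  k1 * k2 * k3 <> 0 ->
  0 < k1 * v + 1 -> 0 < k2 * v + 1 -> 0 < k3 * v + 1 ->
  0 <= l1 * w + 1 -> 0 <= l2 * w + 1 -> 0 <= l3 * w + 1 ->
  0 < 1 - 3 * (k1 * k2 * k3) * v - 3 * (l1 * l2 * l3) * w.
Proof.
  intros Ho Hk P1 P2 P3 Q1 Q2 Q3.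
  rewrite (conformal_factor_as_norm _ _ _ _ _ _ v w Ho).
  destruct Ho as (_ & _ & Hl & _).
  assert (Hsq : forall x, x <> 0 -> 0 < x ^ 2) by (intros x Hx; nra).
  assert (K1 : 0 < k1 ^ 2) by (apply Hsq; intros E; apply Hk; rewrite E; ring).
  assert (K2 : 0 < k2 ^ 2) by (apply Hsq; intros E; apply Hk; rewrite E; ring).
  assert (K3 : 0 < k3 ^ 2) by (apply Hsq; intros E; apply Hk; rewrite E; ring).
  set (A1 := k1 ^ 2 * ((k2 * v + 1) * (k3 * v + 1))).
  set (A2 := k2 ^ 2 * ((k3 * v + 1) * (k1 * v + 1))).
  set (A3 := k3 ^ 2 * ((k1 * v + 1) * (k2 * v + 1))).
  assert (0 < A1)
    by (apply Rmult_lt_0_compat; [|apply Rmult_lt_0_compat]; assumption).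
  assert (0 < A2)
    by (apply Rmult_lt_0_compat; [|apply Rmult_lt_0_compat]; assumption).
  assert (0 < A3)
    by (apply Rmult_lt_0_compat; [|apply Rmult_lt_0_compat]; assumption).
  apply Rlt_le_trans with
    (A1 * (l1 * w + 1) + A2 * (l2 * w + 1) + A3 * (l3 * w + 1));
    [|apply Req_le; unfold A1, A2, A3; ring].
  (* The three nonnegative numbers [l_j w + 1] have sum 3. *)
  assert (Hw : (l1 * w + 1) + (l2 * w + 1) + (l3 * w + 1) = 3).
  { transitivity ((l1 + l2 + l3) * w + 3); [ring|]. rewrite Hl; ring. }
  assert (0 <= A1 * (l1 * w + 1)) by (apply Rmult_le_pos; lra).
  assert (0 <= A2 * (l2 * w + 1)) by (apply Rmult_le_pos; lra).
  assert (0 <= A3 * (l3 * w + 1)) by (apply Rmult_le_pos; lra).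
  destruct (Rle_lt_or_eq_dec _ _ Q1) as [L1|L1];
    [assert (0 < A1 * (l1 * w + 1)) by (apply Rmult_lt_0_compat; lra); lra|].
  destruct (Rle_lt_or_eq_dec _ _ Q2) as [L2|L2];
    [assert (0 < A2 * (l2 * w + 1)) by (apply Rmult_lt_0_compat; lra); lra|].
  assert (0 < A3 * (l3 * w + 1)) by (apply Rmult_lt_0_compat; lra). lra.
Qed.

Lemma ode_system_factor_nonneg (k1 k2 k3 : R) (y1 y2 y3 : R -> C) (v : R -> R) :
  ode_system k1 k2 k3 y1 y2 y3 v -> forall s,
  0 <= k1 * v s + 1 /\ 0 <= k2 * v s + 1 /\ 0 <= k3 * v s + 1.
Proof.
  intros Hode s. destruct (Hode s) as (_ & _ & _ & <- & <- & <-).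
  repeat split; apply pow2_ge_0.
Qed.

Lemma ode_system_factor_pos (k1 k2 k3 : R) (y1 y2 y3 : R -> C) (v : R -> R) (s : R) :
  ode_system k1 k2 k3 y1 y2 y3 v -> Im (y1 s * y2 s * y3 s)%C <> 0 ->
  0 < k1 * v s + 1 /\ 0 < k2 * v s + 1 /\ 0 < k3 * v s + 1.
Proof.
  intros Hode HB. destruct (Hode s) as (_ & _ & _ & <- & <- & <-).
  assert (H : forall z : C, z <> RtoC 0 -> 0 < Cmod z ^ 2)
    by (intros z Hz; apply pow_lt, Cmod_gt_0, Hz).
  repeat split; apply H; intros E; apply HB; rewrite E; simpl; ring.
Qed.

(** * The equation *)

(** The conformal factor solves [F Lap F - |grad F|^2 = 4 |xi|^2 - 4 F^3].
    Here [v1], [w1] stand for the first derivatives of [v], [w], and the second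
    derivatives are already replaced by their values.  The remaining constant
    [1 / 54 - 4 (b^2 + c^2)] vanishes. *)
Lemma conformal_factor_identity (b c v v1 w w1 B C0 : R) :
  b ^ 2 + c ^ 2 = 1 / 216 ->
  v1 ^ 2 = 4 * (1 - v ^ 2 / 2 - 2 * b * v ^ 3 - B ^ 2) ->
  w1 ^ 2 = 4 * (1 - w ^ 2 / 2 - 2 * c * w ^ 3 - C0 ^ 2) ->
  (1 / 6 + b * v + c * w)
    * (b * (- 2 * v - 12 * b * v ^ 2) + c * (- 2 * w - 12 * c * w ^ 2))
  - (b ^ 2 * v1 ^ 2 + c ^ 2 * w1 ^ 2)
  = 4 * ((c * C0) ^ 2 + (b * B) ^ 2) - 4 * (1 / 6 + b * v + c * w) ^ 3.
Proof.
  intros Hbc -> ->.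
  transitivity (4 * ((c * C0) ^ 2 + (b * B) ^ 2) - 4 * (1 / 6 + b * v + c * w) ^ 3
    + (1 / 54 - 4 * (b ^ 2 + c ^ 2))); [field|].
  rewrite Hbc; field.
Qed.

Theorem corollary6p3
  (theta0 : R) (htheta0 : 0 <= theta0 < 2 * PI)
  (y1 y2 y3 : R -> C) (v : R -> R)
  (hy : ode_system (beta1 theta0) (beta2 theta0) (beta3 theta0) y1 y2 y3 v)
  (z1 z2 z3 : R -> C) (w : R -> R)
  (hz : ode_system (gamma1 theta0) (gamma2 theta0) (gamma3 theta0) z1 z2 z3 w)
  (B C0 : R)
  (hB : forall s : R, Im (y1 s * y2 s * y3 s)%C = B)
  (hC : forall t : R, Im (z1 t * z2 t * z3 t)%C = C0)
  (hxi : xi_of theta0 B C0 <> RtoC 0)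
  (om : C) (hom : (om * om * om)%C = xi_of theta0 B C0) :
  (forall p : C, 0 < conf_factor theta0 v w p) /\
  tzitzeica_wrt om (tz_f theta0 B C0 v w).
Proof.
  pose proof (beta_gamma_orthonormal theta0) as Ho.
  pose proof (beta_gamma_prod_sqr theta0) as Hprod.
  pose proof (ode_system_factor_nonneg _ _ _ _ _ _ _ hy) as Py.
  pose proof (ode_system_factor_nonneg _ _ _ _ _ _ _ hz) as Pz.
  set (b := coef_b theta0) in *. set (c := coef_c theta0) in *.
  assert (Hb : beta1 theta0 * beta2 theta0 * beta3 theta0 = - 2 * b)
    by (unfold b, coef_b; field).
  assert (Hc : gamma1 theta0 * gamma2 theta0 * gamma3 theta0 = - 2 * c)
    by (unfold c, coef_c; field).
  assert (Hpos : forall s t, 0 < 1 / 6 + b * v s + c * w t).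
  { intros s t.
    destruct (Py s) as (Py1 & Py2 & Py3). destruct (Pz t) as (Pz1 & Pz2 & Pz3).
    destruct (Req_dec (b * B) 0) as [HbB|HbB].
    - (* The roles of the two systems are exchanged in this case. *)
      assert (HcC : c * C0 <> 0).
      { intros HcC. apply hxi. unfold xi_of. fold b c.
        apply injective_projections; simpl; lra. }
      destruct (ode_system_factor_pos _ _ _ _ _ _ _ t hz) as (Q1 & Q2 & Q3).
      { rewrite hC. intros E. apply HcC. rewrite E. ring. }
      assert (H : 0 < 1 - 3 * (- 2 * c) * w t - 3 * (- 2 * b) * v s); [|lra].
      rewrite <- Hb, <- Hc.
      apply conformal_factor_pos; try assumption.
      + apply orthonormal_coefs_sym, Ho.
      + rewrite Hc. intros E. apply HcC. replace c with 0 by lra. ring.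
    - destruct (ode_system_factor_pos _ _ _ _ _ _ _ s hy) as (Q1 & Q2 & Q3).
      { rewrite hB. intros E. apply HbB. rewrite E. ring. }
      assert (H : 0 < 1 - 3 * (- 2 * b) * v s - 3 * (- 2 * c) * w t); [|lra].
      rewrite <- Hb, <- Hc.
      apply conformal_factor_pos; try assumption.
      rewrite Hb. intros E. apply HbB. replace b with 0 by lra. ring. }
  split; [intros p; apply Hpos|].
  destruct Ho as (Hk & Hk2 & Hl & Hl2 & _).
  destruct (ode_system_energy _ _ _ _ _ _ _ _ Hk Hk2 hy hB) as [v1 Hv].
  destruct (ode_system_energy _ _ _ _ _ _ _ _ Hl Hl2 hz hC) as [w1 Hw].
  rewrite Hb in Hv, Hprod. rewrite Hc in Hw, Hprod.
  set (N := Cmod om).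
  assert (Hom0 : om <> RtoC 0).
  { intros E. apply hxi. rewrite <- hom, E.
    apply injective_projections; simpl; ring. }
  assert (HN : 0 < N) by (apply Cmod_gt_0, Hom0).
  assert (Hxi : Cmod (xi_of theta0 B C0) = N ^ 3).
  { rewrite <- hom, !Cmod_mult. fold N. ring. }
  assert (Hxi2 : (c * C0) ^ 2 + (b * B) ^ 2 = N ^ 6).
  { replace (N ^ 6) with ((N ^ 3) ^ 2) by ring. rewrite <- Hxi, Cmod_pow2.
    unfold xi_of. fold b c. simpl. ring. }
  intros p.
  (* In the coordinate [z' = om * p], the point [p] is [z' * (m + i n)]. *)
  set (m := Re (/ om)%C). set (n := Im (/ om)%C).
  assert (Hmn : m ^ 2 + n ^ 2 = / N ^ 2).
  { unfold m, n. rewrite <- Cmod_pow2, Cmod_inv by exact Hom0. fold N.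
    field. lra. }
  assert (Hp : (om * p / om)%C = p) by (field; exact Hom0).
  set (F := 1 / 6 + b * v (Re p) + c * w (Im p)).
  assert (HF : 0 < F) by apply Hpos.
  (* Since [|xi| = |om|^3], the exponential of [f] is [F / |om|^2]. *)
  assert (Hf : exp (tz_f theta0 B C0 v w p) = F / N ^ 2).
  { unfold tz_f. rewrite Hxi.
    replace (conf_factor theta0 v w p) with F by reflexivity.
    replace (2 / 3 * ln (N ^ 3)) with (ln (N ^ 2))
      by (rewrite !ln_pow by exact HN; simpl; field).
    unfold Rminus. rewrite exp_plus, exp_Ropp, !exp_ln; [reflexivity|..];
      [apply pow_lt|]; assumption. }
  assert (Hf2 : exp (- 2 * tz_f theta0 B C0 v w p) = (N ^ 2 / F) ^ 2).
  { replace (- 2 * tz_f theta0 B C0 v w p)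
      with (- tz_f theta0 B C0 v w p + - tz_f theta0 B C0 v w p) by ring.
    rewrite exp_plus, exp_Ropp, Hf. field. lra. }
  rewrite Hf, Hf2.
  pose proof (is_d_z_zbar_ln_separated v v1
    (fun s => - 2 * v s + 6 * (- 2 * b) * v s ^ 2) w w1
    (fun t => - 2 * w t + 6 * (- 2 * c) * w t ^ 2) (1 / 6) b c m n
    (2 / 3 * ln (Cmod (xi_of theta0 B C0)))
    (fun s => proj1 (Hv s)) (fun s => proj1 (proj2 (Hv s)))
    (fun t => proj1 (Hw t)) (fun t => proj1 (proj2 (Hw t)))
    Hpos (om * p)%C (Re p) (Im p)
    (eq_sym (f_equal Re Hp)) (eq_sym (f_equal Im Hp))) as H.
  cbv beta in H. fold F in H.
  destruct (Hv (Re p)) as (_ & _ & Ev). destruct (Hw (Im p)) as (_ & _ & Ew).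
  assert (Hbc : b ^ 2 + c ^ 2 = 1 / 216) by lra.
  assert (Ev' : v1 (Re p) ^ 2
    = 4 * (1 - v (Re p) ^ 2 / 2 - 2 * b * v (Re p) ^ 3 - B ^ 2))
    by (rewrite Ev; ring).
  assert (Ew' : w1 (Im p) ^ 2
    = 4 * (1 - w (Im p) ^ 2 / 2 - 2 * c * w (Im p) ^ 3 - C0 ^ 2))
    by (rewrite Ew; ring).
  pose proof (conformal_factor_identity b c _ _ _ _ B C0 Hbc Ev' Ew') as Hid.
  fold F in Hid. rewrite Hxi2 in Hid.
  replace ((N ^ 2 / F) ^ 2 - F / N ^ 2) with ((m ^ 2 + n ^ 2) / 4 *
    ((F * (b * (- 2 * v (Re p) + 6 * (- 2 * b) * v (Re p) ^ 2)
         + c * (- 2 * w (Im p) + 6 * (- 2 * c) * w (Im p) ^ 2))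
      - (b ^ 2 * v1 (Re p) ^ 2 + c ^ 2 * w1 (Im p) ^ 2)) / F ^ 2)).
  - exact H.
  - rewrite Hmn.
    replace (F * _ - _) with (4 * N ^ 6 - 4 * F ^ 3) by (rewrite <- Hid; ring).
    field. split; lra.
Qed.
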